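(* Let $\mathcal{C}$ be a category of partitions and let $N\in\mathbb{N}$ be such that for all $k,l\in\mathbb{N}$ the collection of linear maps $\{T_p:p\in\mathcal{C}(k,l)\}$ (formed in dimension $N$) is linearly independent. Then for any finite group $G$ the moments $(m_n(\chi_{\mathcal{V}}))_{n\in\mathbb{N}}$ of the character $\chi_{\mathcal{V}}$ of the fundamental representation $\mathcal{V}$ of $G\wr\mathbb{G}_N(\mathcal{C})$ with respect to the Haar state are given by $$m_n(\chi_{\mathcal{V}})=\sum_{p\in\mathcal{C}(0,n)}\ \prod_{b\subset p}|G|^{|b|-1},$$ where the product is over the blocks $b$ of $p$ and $|b|$ is the number of points of $b$.
   Context: Partitions. $P(k,l)$ is the set of partitions of $k+l$ points, drawn as a row of $k$ upper points and a row of $l$ lower points. Category operations: horizontal concatenation $p\otimes q$; composition $pq\in P(k,m)$ of $p\in P(l,m)$ and $q\in P(k,l)$ (put $q$ above $p$, glue the lower points of $q$ to the upper points of $p$, erase the middle points, discarding the components consisting only of middle points); involution $p^*$ (upside-down flip); rotation (moving the leftmost, or rightmost, point of one row to the same end of the other row, keeping it in its block). A category of partitions $\mathcal{C}$ is a collection of subsets $\mathcal{C}(k,l)\subseteq P(k,l)$, $k,l\in\mathbb{N}$, stable under all these operations and containing the identity partition $\vert\in P(1,1)$. For a basis $(e_1,\dots,e_N)$ of $\mathbb{C}^N$, $T_p:(\mathbb{C}^N)^{\otimes k}\to(\mathbb{C}^N)^{\otimes l}$ is $T_p(e_{\boldsymbol i})=\sum_{\boldsymbol j}\delta_p(\boldsymbol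 i,\boldsymbol j)e_{\boldsymbol j}$, with $\delta_p(\boldsymbol i,\boldsymbol j)=1$ if, writing the indices $\boldsymbol i$ on the upper and $\boldsymbol j$ on the lower points of $p$, indices in the same block are equal, and $0$ otherwise. Partition wreath product. $\mathcal{C}^G(k,l)$ is the set of partitions in $\mathcal{C}(k,l)$ with an element of $G$ (colour) attached to each point. Let $V=\bigoplus_{g\in G}V^g$, where $V^g$ is a copy of $\mathbb{C}^N$ with basis $(e_i^g)_{1\leqslant i\leqslant N}$ (all $e_i^g$ orthonormal). If $p\in\mathcal{C}^G(k,l)$ has upper colours $g_1,\dots,g_k$ and lower colours $h_1,\dots,h_l$, then $T_p:V^{g_1}\otimes\dots\otimes V^{g_k}\to V^{h_1}\otimes\dots\otimes V^{h_l}$ is given by $T_p(e_{i_1}^{g_1}\otimes\dots\otimes e_{i_k}^{g_k})=\sum_{j_1,\dots,j_l=1}^N\delta_p(\boldsymbol i,\boldsymbol j)\,e_{j_1}^{h_1}\otimes\dots\otimes e_{j_l}^{h_l}$, where $\delta_p(\boldsymbol i,\boldsymbol j)$ is computed from the underlying uncoloured partition of $p$ ($1$ if indices in the same block are equal, $0$ otherwise), extended by $0$ on the other summands of $V^{\otimes k}$. Let $b(p)$ be the number of blocks of $p$, ordered by leftmost point; $(g_1,\dots,g_{b(p)}).p$ is obtained from $p$ by multiplying on the left by $g_i$ all the colours of the points of the $i$-th block. Set $M_p=\sum_{(g_1,\dots,g_{b(p)})\in G^{b(p)}}T_{(g_1,\dots,g_{b(p)}).p}$. The partition wreath product $G\wr\mathbb{G}_N(\mathcal{C})$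 is the compact quantum group (in the sense of Woronowicz) given by Tannaka-Krein duality, having a fundamental unitary representation $\mathcal{V}$ on $V$, whose coefficients generate a dense subalgebra, with intertwiner spaces $\mathrm{Hom}(\mathcal{V}^{\otimes k},\mathcal{V}^{\otimes l})=\mathrm{Span}\{M_p:p\in\mathcal{C}^G(k,l)\}$ for all $k,l\in\mathbb{N}$. The character is $\chi_{\mathcal{V}}=(\mathrm{id}\otimes\mathrm{Tr})(\mathcal{V})\in C(G\wr\mathbb{G}_N(\mathcal{C}))$, and $m_n(\chi_{\mathcal{V}})=h(\chi_{\mathcal{V}}^n)$ with $h$ the Haar state. *)

(* Defs.v *)
From HB Require Import structures.
From mathcomp Require Import all_boot all_order all_algebra all_fingroup.
From mathcomp Require Import complex.
From mathcomp Require Import classical_sets reals.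

Set Implicit Arguments.
Unset Strict Implicit.
Unset Printing Implicit Defensive.

Import Order.TTheory GRing.Theory Num.Theory.
Import ComplexField.Normc.

Local Open Scope ring_scope.

(* The points of a partition in P(k, l): [inl a] is the a-th upper point and
   [inr b] the b-th lower point, both rows being read from left to right. *)
Notation points k l := ('I_k + 'I_l)%type.
Notation blocks k l := {set {set points k l}}.

Section PartitionOperations.

Definition relabel (S T : finType) (f : S -> T) (p : {set {set S}}) :
  {set {set T}} := ([set f @: B | B : {set S} in p])%SET.

Definition pid : blocks 1 1 := [set [set: points 1 1]]%SET.

Definition tens_left (k l k' l' : nat) (x : points k l) :
    points (k + k') (l + l') :=
  match x with inl a => inl (lshift k' a) | inr b => inr (lshift l' b) end.

Definition tens_right (k l k' l' : nat) (x : points k' l') :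
    points (k + k') (l + l') :=
  match x with inl a => inl (rshift k a) | inr b => inr (rshift l b) end.

Definition ptensor (k l k' l' : nat) (p : blocks k l) (q : blocks k' l') :
    blocks (k + k') (l + l') :=
  (relabel (@tens_left k l k' l') p :|: relabel (@tens_right k l k' l') q)%SET.

Definition flip_points (k l : nat) (x : points k l) : points l k :=
  match x with inl a => inr a | inr b => inl b end.

Definition pinvol (k l : nat) (p : blocks k l) : blocks l k :=
  relabel (@flip_points k l) p.

(* Vertical stacking: the upper row of q, the common middle row, and the lower
   row of p.  Blocks of pq are the traces on the two outer rows of the
   connected components of the stack. *)
Definition stack_top (k l m : nat) (x : points k l) :
    ('I_k + 'I_l + 'I_m)%type :=
  inl x.

Definition stack_bot (k l m : nat) (x : points l m) :
    ('I_k + 'I_l + 'I_m)%type :=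
  match x with inl b => inl (inr b) | inr c => inr c end.

Definition stack_out (k l m : nat) (x : points k m) :
    ('I_k + 'I_l + 'I_m)%type :=
  match x with inl a => inl (inl a) | inr c => inr c end.

Definition same_block (T : finType) (p : {set {set T}}) : rel T :=
  fun x y => [exists B in p, (x \in B) && (y \in B)].

Definition stack_rel (k l m : nat) (p : blocks l m) (q : blocks k l) :
    rel ('I_k + 'I_l + 'I_m)%type :=
  fun x y => same_block (relabel (@stack_top k l m) q) x y
          || same_block (relabel (@stack_bot k l m) p) x y.

Definition pcompose (k l m : nat) (p : blocks l m) (q : blocks k l) : blocks k m :=
  equivalence_partition
    (fun x y => connect (stack_rel p q) (stack_out l x) (stack_out l y))
    [set: points k m].

(* Move the upper point h down so that it becomes the lower point h', the
   other points keeping their order; h = h' = ord0 gives the rotation on the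
   left and h = h' = ord_max the one on the right. *)
Definition rot_down (k l : nat) (h : 'I_k.+1) (h' : 'I_l.+1)
    (x : points k.+1 l) : points k l.+1 :=
  match x with
  | inl a => if unlift h a is Some a' then inl a' else inr h'
  | inr b => inr (lift h' b)
  end.

Definition rot_up (k l : nat) (h : 'I_k.+1) (h' : 'I_l.+1)
    (x : points k l.+1) : points k.+1 l :=
  match x with
  | inl a => inl (lift h a)
  | inr b => if unlift h' b is Some b' then inr b' else inl h
  end.

End PartitionOperations.

Record partition_category := PartitionCategory {
  pcat :> forall k l : nat, {set blocks k l};
  pcat_partition : forall k l (p : blocks k l),
    p \in pcat k l -> finset.partition p [set: points k l]%SET;
  pcat_id : pid \in pcat 1 1;
  pcat_tensor : forall k l k' l' (p : blocks k l) (q : blocks k' l'),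
    p \in pcat k l -> q \in pcat k' l' ->
    ptensor p q \in pcat (k + k') (l + l');
  pcat_comp : forall k l m (p : blocks l m) (q : blocks k l),
    p \in pcat l m -> q \in pcat k l -> pcompose p q \in pcat k m;
  pcat_invol : forall k l (p : blocks k l),
    p \in pcat k l -> pinvol p \in pcat l k;
  pcat_rot_down_left : forall k l (p : blocks k.+1 l),
    p \in pcat k.+1 l -> relabel (rot_down ord0 ord0) p \in pcat k l.+1;
  pcat_rot_down_right : forall k l (p : blocks k.+1 l),
    p \in pcat k.+1 l -> relabel (rot_down ord_max ord_max) p \in pcat k l.+1;
  pcat_rot_up_left : forall k l (p : blocks k l.+1),
    p \in pcat k l.+1 -> relabel (rot_up ord0 ord0) p \in pcat k.+1 l;
  pcat_rot_up_right : forall k l (p : blocks k l.+1),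
    p \in pcat k l.+1 -> relabel (rot_up ord_max ord_max) p \in pcat k.+1 l
}.

(* Let W be a space with basis indexed by I.  The tensor power W^(ox k) has the
   basis indexed by {ffun 'I_k -> I}; a linear map T from W^(ox k) to W^(ox l)
   is given by its matrix in these bases, T (j, i) being the coefficient of e_j
   in T(e_i). *)
Notation tensor_map K I k l :=
  {ffun ({ffun 'I_l -> I} * {ffun 'I_k -> I})%type -> K^o}.

Section PartitionMaps.

Definition pdelta (N k l : nat) (p : blocks k l)
    (i : {ffun 'I_k -> 'I_N}) (j : {ffun 'I_l -> 'I_N}) : bool :=
  let idx (x : points k l) := match x with inl a => i a | inr b => j b end in
  [forall x, forall y, same_block p x y ==> (idx x == idx y)].

Definition Tmap (K : fieldType) (N k l : nat) (p : blocks k l) :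
    tensor_map K 'I_N k l :=
  [ffun ji => (pdelta p ji.2 ji.1)%:R].

(* The basis vector e_i^g of V is indexed by the pair (g, i). *)
Definition colTmap (K : fieldType) (G : finGroupType) (N k l : nat)
    (p : blocks k l) (c : {ffun points k l -> G}) :
    tensor_map K (G * 'I_N)%type k l :=
  [ffun ji : {ffun 'I_l -> G * 'I_N} * {ffun 'I_k -> G * 'I_N} =>
    [&& [forall a, (ji.2 a).1 == c (inl a)],
        [forall b, (ji.1 b).1 == c (inr b)] &
        pdelta p [ffun a => (ji.2 a).2] [ffun b => (ji.1 b).2]]%:R].

(* The blocks of p are numbered by [enum p]: since Mmap sums over all tuples
   in G^b(p), the chosen numbering of the blocks does not affect it. *)
Definition block_act (G : finGroupType) (k l : nat) (p : blocks k l)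
    (g : #|p|.-tuple G) (c : {ffun points k l -> G}) : {ffun points k l -> G} :=
  [ffun x => (nth 1 g (index (finset.pblock p x) (enum p)) * c x)%g].

Definition Mmap (K : fieldType) (G : finGroupType) (N k l : nat)
    (p : blocks k l) (c : {ffun points k l -> G}) :
    tensor_map K (G * 'I_N)%type k l :=
  \sum_(g : #|p|.-tuple G) colTmap K N p (block_act g c).

End PartitionMaps.

HB.mixin Record isCStarAlgebra (R : realType) A of GRing.Algebra R[i] A := {
  star : A -> A;
  starK : involutive star;
  starD : forall x y, star (x + y) = star x + star y;
  starZ : forall (a : R[i]) x, star (a *: x) = a^* *: star x;
  starM : forall x y, star (x * y) = star y * star x;
  cnorm : A -> R;
  cnormD : forall x y, cnorm (x + y) <= cnorm x + cnorm y;
  cnormZ : forall (a : R[i]) x, cnorm (a *: x) = normc a * cnorm x;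
  cnorm0_eq0 : forall x, cnorm x = 0 -> x = 0;
  cnormM : forall x y, cnorm (x * y) <= cnorm x * cnorm y;
  cnorm_cstar : forall x, cnorm (star x * x) = cnorm x ^+ 2;
  cnorm_complete : forall u : nat -> A,
    (forall e : R, 0 < e -> exists n0, forall m n, (n0 <= m)%N -> (n0 <= n)%N ->
       cnorm (u m - u n) < e) ->
    exists x, forall e : R, 0 < e -> exists n0, forall n, (n0 <= n)%N ->
      cnorm (u n - x) < e
}.

#[short(type="cstarAlgType")]
HB.structure Definition CStarAlgebra (R : realType) :=
  {A of GRing.Algebra R[i] A & isCStarAlgebra R A}.

Section Tensor.
Variable R : realType.

Local Open Scope classical_set_scope.

Definition span_closed (A : lmodType R[i]) (S : set A) : Prop :=
  S 0 /\ forall (a : R[i]) x y, S x -> S y -> S (a *: x + y).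

Definition linear_span (A : lmodType R[i]) (X : set A) : set A :=
  smallest (@span_closed A) X.

Definition subalgebra_closed (A : algType R[i]) (S : set A) : Prop :=
  [/\ span_closed S, S 1 & forall x y, S x -> S y -> S (x * y)].

Definition generated_algebra (A : algType R[i]) (X : set A) : set A :=
  smallest (@subalgebra_closed A) X.

Definition cdense (A : cstarAlgType R) (S : set A) : Prop :=
  forall x (e : R), 0 < e -> exists2 y, S y & cnorm (x - y) < e.

Definition bounded_map (A B : cstarAlgType R) (f : A -> B) : Prop :=
  exists K : R, forall x, cnorm (f x) <= K * cnorm x.

Definition star_preserving (A B : cstarAlgType R) (f : A -> B) : Prop :=
  forall x, f (star x) = star (f x).

(* D, with t a b in the role of a (x) b, is the completion of the algebraic
   tensor product of A and B for some C*-norm; [ct_inj] says that the algebraic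
   tensor product embeds in D. *)
Record cstar_tensor (A B D : cstarAlgType R) (t : A -> B -> D) : Prop :=
  CStarTensor {
  ct_linearl : forall b (z : R[i]) a a', t (z *: a + a') b = z *: t a b + t a' b;
  ct_linearr : forall a (z : R[i]) b b', t a (z *: b + b') = z *: t a b + t a b';
  ct_one : t 1 1 = 1;
  ct_mul : forall a a' b b', t a b * t a' b' = t (a * a') (b * b');
  ct_star : forall a b, star (t a b) = t (star a) (star b);
  ct_inj : forall n (a : 'I_n -> A) (b : 'I_n -> B),
    (forall z : 'I_n -> R[i], \sum_i z i *: a i = 0 -> forall i, z i = 0) ->
    \sum_i t (a i) (b i) = 0 -> forall i, b i = 0;
  ct_dense : cdense (linear_span [set t a b | a in [set: A] & b in [set: B]])
}.

Definition min_tensor (A B D : cstarAlgType R) (t : A -> B -> D) : Prop :=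
  cstar_tensor t /\
  forall (E : cstarAlgType R) (s : A -> B -> E), cstar_tensor s ->
  forall n (a : 'I_n -> A) (b : 'I_n -> B),
    cnorm (\sum_i t (a i) (b i)) <= cnorm (\sum_i s (a i) (b i)).

(* (Delta (x) id) Delta = (id (x) Delta) Delta, computed in a C*-algebra E
   realising both (A (x) A) (x) A and A (x) (A (x) A). *)
Definition coassociative (A D : cstarAlgType R) (t : A -> A -> D)
    (Delta : A -> D) : Prop :=
  exists (E : cstarAlgType R) (tl : D -> A -> E) (tr : A -> D -> E),
  [/\ min_tensor tl, min_tensor tr,
      forall a b c, tl (t a b) c = tr a (t b c) &
      exists f g : {lrmorphism D -> E},
      [/\ star_preserving f, star_preserving g,
          forall a b, f (t a b) = tl (Delta a) b,
          forall a b, g (t a b) = tr a (Delta b) &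
          forall a, f (Delta a) = g (Delta a)]].

End Tensor.

Section CompactQuantumGroup.
Variable R : realType.

Local Open Scope classical_set_scope.

(* A compact quantum group in the sense of Woronowicz; the last two axioms are
   the density (cancellation) conditions. *)
Record compact_quantum_group := CompactQuantumGroup {
  qalg : cstarAlgType R;
  qalg2 : cstarAlgType R;
  qtens : qalg -> qalg -> qalg2;
  qtens_min : min_tensor qtens;
  Delta : {lrmorphism qalg -> qalg2};
  Delta_star : star_preserving Delta;
  Delta_coassoc : coassociative qtens Delta;
  Delta_densel : cdense (linear_span
    [set qtens b 1 * Delta c | b in [set: qalg] & c in [set: qalg]]);
  Delta_denser : cdense (linear_span
    [set qtens 1 b * Delta c | b in [set: qalg] & c in [set: qalg]])
}.

Variable Q : compact_quantum_group.
Local Notation A := (qalg Q).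

Definition state (h : {scalar A}) : Prop :=
  h 1 = 1 /\ forall a, 0 <= h (star a * a).

(* The bounded linear maps sl and sr are the slice maps h (x) id and
   id (x) h. *)
Definition haar_state (h : {scalar A}) : Prop :=
  state h /\
  exists sl sr : {linear qalg2 Q -> A},
  [/\ bounded_map sl, bounded_map sr,
      forall a b, sl (qtens a b) = h a *: b,
      forall a b, sr (qtens a b) = h b *: a &
      forall a, sl (Delta Q a) = h a *: 1 /\ sr (Delta Q a) = h a *: 1].

Variable I : finType.

(* A representation on the space with orthonormal basis indexed by I is given
   by its matrix of coefficients. *)
Definition unitary_representation (V : I -> I -> A) : Prop :=
  [/\ forall x y, Delta Q (V x y) = \sum_z qtens (V x z) (V z y),
      forall x y, \sum_z V x z * star (V y z) = (x == y)%:R &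
      forall x y, \sum_z star (V z x) * V z y = (x == y)%:R].

Definition tensor_power (V : I -> I -> A) (k : nat) (i j : {ffun 'I_k -> I}) : A :=
  \prod_(a < k) V (i a) (j a).

(* T is in Hom(V^(ox k), V^(ox l)) when (T (x) 1) V^(ox k) = V^(ox l) (T (x) 1). *)
Definition intertwiner (V : I -> I -> A) (k l : nat)
    (T : tensor_map R[i] I k l) : Prop :=
  forall (j : {ffun 'I_l -> I}) (i : {ffun 'I_k -> I}),
    \sum_i' T (j, i') *: tensor_power V i' i =
    \sum_j' T (j', i) *: tensor_power V j j'.

Definition rep_character (V : I -> I -> A) : A := \sum_x V x x.

Definition moment (h : {scalar A}) (n : nat) (a : A) : R[i] := h (a ^+ n).

End CompactQuantumGroup.

Definition partition_wreath_product (R : realType) (C : partition_category)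
    (N : nat) (G : finGroupType) (Q : compact_quantum_group R)
    (V : G * 'I_N -> G * 'I_N -> qalg Q) : Prop :=
  [/\ unitary_representation V,
      cdense (generated_algebra [set a | exists x y, a = V x y]%classic) &
      forall (k l : nat) (T : tensor_map R[i] (G * 'I_N)%type k l),
        intertwiner V T <->
        T \in (<<[seq Mmap R[i] N pc.1 pc.2 | pc :
                   blocks k l * {ffun points k l -> G} in
                   finset.setX (C k l) [set: {ffun points k l -> G}]%SET]>>)%VS].

(* Main.v *)
Require Import Defs.
From mathcomp Require Import all_boot all_order all_algebra all_fingroup.
From mathcomp Require Import complex reals.

Set Implicit Arguments.
Unset Strict Implicit.
Unset Printing Implicit Defensive.

Import GRing.Theory.

Local Open Scope ring_scope.

(** The n-th moment is the trace of the matrix P = (h(V^n_ij)), where V^n_ij are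
    the coefficients of the n-th tensor power of V. Expanding
    Delta (V^n_ij) = sum_z V^n_iz (x) V^n_zj and slicing with the Haar state h
    shows that every column of P is a fixed vector of the tensor power, that is,
    an intertwiner from its power 0 ([haar_column_intertwiner]). Conversely,
    applying h to the equation that defines a fixed vector v gives P v = v
    ([intertwiner_haar_fixed]). Thus P is a projector onto the fixed vectors and
    its trace is their dimension ([moment_eq_dim]).

    It remains to compute the dimension of the span of the maps M_(p, c), for p
    in C(0, n) and c a colouring of its points ([dim_span_Mmap]). Block
    multiplications act freely on the colourings, and M_(p, c) is the sum of T_p
    over the orbit of c. Every orbit contains exactly one normal colouring,
    meaning one that takes the value 1 at a chosen root of each block. Hence,
    restricted to the entries of a given colour d, the map M_(p, c) is T_p if
    c and d have the same normal form for p and 0 otherwise ([MmapE]). So a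
    linear relation between the M_(p, c) with c normal restricts, on each colour
    d, to a relation between the T_p, and freeness of the T_p passes to these
    M_(p, c). Finally, a block b leaves |b| - 1 free colours to a normal
    colouring ([card_normal_colouring]). *)

(** * Two facts of linear algebra *)

Lemma free_imageP (K : fieldType) (E : vectType K) (T : finType)
    (A : {pred T}) (F : T -> E) :
  reflect (forall z : T -> K, \sum_(x in A) z x *: F x = 0 ->
             forall x, x \in A -> z x = 0)
    (free [seq F x | x in A]).
Proof.
have szA : size [seq F x | x in A] == #|A| by rewrite size_map cardE.
rewrite -[image F A]/(tval (Tuple szA)).
have nthA (i : 'I_#|A|) : (Tuple szA)`_i = F (enum_val i).
  by rewrite /= (nth_map (enum_default i)) -?cardE.
apply: (iffP freeP) => [freeF z zF x xA|freeF z zF i].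
  have := freeF (fun i => z (enum_val i)) _ (enum_rank_in xA x).
  rewrite enum_rankK_in //; apply.
  rewrite -[RHS]zF [RHS]big_enum_val.
  by apply: eq_bigr => i _; rewrite nthA.
have iA := enum_valP i.
rewrite -[i in LHS](enum_valK_in iA).
apply: (freeF (fun x => z (enum_rank_in iA x))) => [|]; last exact: enum_valP.
rewrite big_enum_val -[RHS]zF; apply: eq_bigr => j _.
by rewrite nthA enum_valK_in.
Qed.

(** If v = sum_s v_s P_s on U, then P is a projector onto U. Expanding each
    column P_s in a basis B of U, the trace becomes the sum over k of the k-th
    coordinate of P B_k = B_k, and each of these coordinates is 1. *)
Lemma trace_projector (K : fieldType) (S : finType)
    (U : {vspace {ffun S -> K^o}}) (P : S -> {ffun S -> K^o}) :
  (forall s, P s \in U) -> (forall v, v \in U -> \sum_s v s *: P s = v) ->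
  \sum_s P s s = (\dim U)%:R.
Proof.
move=> PU Pid; pose B := vbasis U.
have entry s : P s s = \sum_(k < \dim U) (B`_k s : K) * coord B k (P s).
  rewrite {1}(coord_vbasis (PU s)) sum_ffunE.
  by apply: eq_bigr => k _; rewrite ffunE [LHS]mulrC.
rewrite (eq_bigr _ (fun s _ => entry s)) exchange_big /=.
rewrite -[X in _ = X%:R]card_ord -sumr_const; apply: eq_bigr => k _.
have BkU : B`_k \in U by rewrite vbasis_mem // mem_nth // size_tuple.
transitivity (coord B k (\sum_s (B`_k s : K) *: P s)).
  by rewrite linear_sum; apply: eq_bigr => s _; rewrite linearZ.
by rewrite Pid // coord_free ?eqxx // (basis_free (vbasisP U)).
Qed.

(** * Orbits of colourings under block multiplication *)

Section BlockColourings.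
Variables (G : finGroupType) (k l : nat) (p : blocks k l).
Hypothesis p_part : finset.partition p [set: points k l].

Local Notation roots := (finset.transversal p [set: points k l]).

Definition block_root (x : points k l) : points k l :=
  finset.transversal_repr x roots (finset.pblock p x).

(** The representative of the orbit of c that equals 1 at every block root. *)
Definition normalise (c : {ffun points k l -> G}) : {ffun points k l -> G} :=
  [ffun x => ((c (block_root x))^-1 * c x)%g].

Definition normal_colouring : pred {ffun points k l -> G} :=
  [pred c | normalise c == c].

Let pblock_in x : finset.pblock p x \in p.
Proof. by rewrite finset.pblock_mem // (finset.cover_partition p_part) inE. Qed.

Let mem_own_pblock x : x \in finset.pblock p x.
Proof. by rewrite finset.mem_pblock (finset.cover_partition p_part) inE. Qed.

Let p_triv : finset.trivIset p.
Proof. by case/and3P: p_part. Qed.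

Lemma pblock_root x : finset.pblock p (block_root x) = finset.pblock p x.
Proof. exact: (finset.transversal_reprK (finset.transversalP p_part)). Qed.

Lemma eq_block_root x y :
  finset.pblock p x = finset.pblock p y -> block_root x = block_root y.
Proof.
move=> exy; rewrite /block_root exy; apply: finset.set1_inj.
by rewrite -!(finset.setI_transversal_pblock (finset.transversalP p_part)).
Qed.

Lemma block_rootK x : block_root (block_root x) = block_root x.
Proof. by apply: eq_block_root; rewrite pblock_root. Qed.

Lemma normaliseK c : normalise (normalise c) = normalise c.
Proof.
by apply/ffunP => x; rewrite !ffunE block_rootK mulVg invg1 mul1g.
Qed.

Lemma normalise_act (g : #|p|.-tuple G) c :
  normalise (block_act g c) = normalise c.
Proof.
by apply/ffunP => x; rewrite !ffunE pblock_root invMg -mulgA mulKg.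
Qed.

(** The multiplier turning c into d must be d x / c x at every point x, so it has
    to be constant on blocks. *)
Lemma eq_normalise_ratio c d : normalise c = normalise d ->
  forall x y, finset.pblock p x = finset.pblock p y ->
  (d x * (c x)^-1 = d y * (c y)^-1)%g.
Proof.
move=> ecd.
suff ratio_root x : (d x * (c x)^-1 =
    d (block_root x) * (c (block_root x))^-1)%g.
  by move=> x y exy; rewrite (ratio_root x) (ratio_root y) (eq_block_root exy).
have /ffunP/(_ x) := ecd; rewrite !ffunE => e.
by rewrite -[d x](mulKVg (d (block_root x))) -e mulgA mulgK.
Qed.

(** Two colourings with the same normal form differ by a unique tuple of block
    multipliers: the action of G^b(p) is free, and [normalise] separates its
    orbits. *)
Lemma card_block_act_eq c d :
  #|[pred g : #|p|.-tuple G | d == block_act g c]| =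
  (normalise c == normalise d).
Proof.
have [ecd|ncd] := eqVneq; last first.
  apply: eq_card0 => g; rewrite inE; apply: contraNF ncd => /eqP->.
  by rewrite normalise_act.
(* On a block of p the value does not depend on the picked point, by
   [eq_normalise_ratio]. *)
pose ratio (B : {set points k l}) : G :=
  if [pick x in B] is Some x then (d x * (c x)^-1)%g else 1%g.
have ratioE x : ratio (finset.pblock p x) = (d x * (c x)^-1)%g.
  rewrite /ratio; case: pickP => [y yx|/(_ x)]; last by rewrite mem_own_pblock.
  by apply: eq_normalise_ratio => //; apply: finset.same_pblock.
have size_enum : size (enum p) = #|p| by rewrite cardE.
have idx_lt x : (index (finset.pblock p x) (enum p) < #|p|)%N.
  by rewrite -size_enum index_mem mem_enum.
rewrite -[RHS](card1 (map_tuple ratio (enum_tuple p))); apply: eq_card => g.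
rewrite !inE; apply/eqP/eqP => [dE|->]; last first.
  apply/ffunP => x; rewrite ffunE /= (nth_map finset.set0) ?size_enum //.
  by rewrite nth_index ?mem_enum // ratioE mulgKV.
apply/val_inj/(@eq_from_nth _ 1%g); rewrite ?size_tuple // => i ltip.
rewrite (nth_map finset.set0) ?size_enum //.
set B := nth finset.set0 _ i.
have Bp : B \in p by rewrite -mem_enum mem_nth ?size_enum.
have /finset.set0Pn[x xB] : B != finset.set0.
  by apply: contraTneq Bp => ->; case/and3P: p_part.
have Bx : finset.pblock p x = B by exact: finset.def_pblock.
rewrite -Bx ratioE dE ffunE Bx index_uniq ?size_enum ?enum_uniq //.
by rewrite mulgK.
Qed.

(** A normal colouring is an arbitrary function on the points that are not block
    roots, extended by 1. *)
Lemma card_normal_colouring :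
  #|normal_colouring| = (\prod_(b in p) #|G| ^ #|b|.-1)%N.
Proof.
have trP := finset.transversalP p_part.
have root_in x : block_root x \in roots.
  exact: (finset.repr_mem_transversal trP).
have root_id x : x \in roots -> block_root x = x.
  by move=> xX; apply: (finset.pblockK trP).
have -> : #|normal_colouring| = #|pffun_on (1%g : G) (~: roots)%SET G|.
  apply: eq_card => c; rewrite inE; apply/eqP/pffun_onP => [cn|[csup _]].
    split=> [|y _]; last by rewrite inE.
    apply/fintype.subsetP => x; rewrite inE /= -cn ffunE !inE.
    by apply: contraNN => /root_id->; rewrite mulVg.
  apply/ffunP => x; rewrite ffunE.
  suff -> : c (block_root x) = 1%g by rewrite invg1 mul1g.
  apply/eqP; apply: contraTT (root_in x) => cx.
  by have := fintype.subsetP csup (block_root x); rewrite !inE => /(_ cx).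
rewrite card_pffun_on -expn_sum; congr (_ ^ _)%N.
have := finset.cardsC roots; rewrite -cardsT (finset.card_transversal trP).
rewrite (finset.card_partition p_part) -sum1_card.
have -> : (\sum_(A in p) #|A| = \sum_(A in p) 1 + \sum_(A in p) #|A|.-1)%N.
  rewrite -big_split; apply: eq_bigr => A Ap /=; rewrite add1n prednK //.
  rewrite finset.card_gt0.
  by apply: contraTneq Ap => ->; case/and3P: p_part.
by move/eqP; rewrite eqn_add2l => /eqP.
Qed.

End BlockColourings.

(** * The dimension of the span of the maps M *)

Section Dimension.
Variables (K : fieldType) (G : finGroupType) (N k l : nat).

Local Notation multi_index :=
  ({ffun 'I_l -> G * 'I_N} * {ffun 'I_k -> G * 'I_N})%type.

Definition index_colour (ji : multi_index) : {ffun points k l -> G} :=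
  [ffun x => match x with inl a => (ji.2 a).1 | inr b => (ji.1 b).1 end].

Definition index_coord (ji : multi_index) :
    {ffun 'I_l -> 'I_N} * {ffun 'I_k -> 'I_N} :=
  ([ffun b => (ji.1 b).2], [ffun a => (ji.2 a).2]).

Definition coloured_index (d : {ffun points k l -> G})
    (ji : {ffun 'I_l -> 'I_N} * {ffun 'I_k -> 'I_N}) : multi_index :=
  ([ffun b => (d (inr b), ji.1 b)], [ffun a => (d (inl a), ji.2 a)]).

Lemma coloured_indexK d ji :
  index_colour (coloured_index d ji) = d /\
  index_coord (coloured_index d ji) = ji.
Proof.
split; first by apply/ffunP => -[x|x]; rewrite !ffunE.
by case: ji => j i; congr (_, _); apply/ffunP => x; rewrite !ffunE.
Qed.

Lemma colTmapE (p : blocks k l) c ji :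
  colTmap K N p c ji =
  (index_colour ji == c)%:R * Tmap K N p (index_coord ji) :> K.
Proof.
rewrite !ffunE -natrM mulnb; congr (nat_of_bool _)%:R; rewrite andbA.
congr (_ && _); apply/andP/eqP => [[/forallP up /forallP low]|<-].
  by apply/ffunP => -[a|b]; rewrite ffunE; apply/eqP.
by split; apply/forallP => a; rewrite ffunE.
Qed.

(** By freeness of the action, at most one term of the sum defining M_(p, c) has
    the colour of the given entry, and one does precisely when this colour lies
    in the orbit of c. *)
Lemma MmapE (p : blocks k l) (c : {ffun points k l -> G}) ji :
  finset.partition p [set: points k l] ->
  Mmap K N p c ji =
  (normalise p c == normalise p (index_colour ji))%:R *
  Tmap K N p (index_coord ji) :> K.
Proof.
move=> p_part; rewrite sum_ffunE.
under eq_bigr do rewrite colTmapE.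
rewrite -mulr_suml -natr_sum -card_block_act_eq //; congr (_%:R * _).
by rewrite -[RHS]sum1_card [RHS]big_mkcond.
Qed.

Lemma Mmap_normalise (p : blocks k l) (c : {ffun points k l -> G}) :
  finset.partition p [set: points k l] ->
  Mmap K N p (normalise p c) = Mmap K N p c.
Proof. by move=> p_part; apply/ffunP => ji; rewrite !MmapE // normaliseK. Qed.

(** At the entries of colour d, and for each p, only the map M_(p, c) with c the
    normal form of d survives, and it restricts to T_p. Choosing d to be the
    normal colouring whose coefficient is sought, freeness of the T_p shows that
    this coefficient vanishes. *)
Lemma free_normal_Mmap (C : {set blocks k l}) :
  (forall p, p \in C -> finset.partition p [set: points k l]) ->
  free [seq Tmap K N p | p in C] ->
  free [seq Mmap K N pc.1 pc.2 | pc : blocks k l * {ffun points k l -> G} in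
    [pred pc | (pc.1 \in C) && normal_colouring pc.1 pc.2]].
Proof.
move=> C_part freeT; apply/free_imageP => z z0 [p c] /andP[/= pC /eqP cn].
have /= := free_imageP _ _ freeT (fun q => z (q, normalise q c)) _ p pC.
rewrite cn; apply; apply/ffunP => ji.
have /ffunP/(_ (coloured_index c ji)) := z0; rewrite !sum_ffunE !ffunE => z0ji.
rewrite -[RHS]z0ji.
transitivity (\sum_(q in C) \sum_(d | normal_colouring q d)
    (z (q, d) *: Mmap K N q d) (coloured_index c ji)); last first.
  by rewrite pair_big_dep; apply: eq_big => -[].
have scaleE (a : K) (S : finType) (f : {ffun S -> K^o}) x : (a *: f) x = a * f x.
  by rewrite ffunE.
apply: eq_bigr => q qC; rewrite scaleE (bigD1 (normalise q c)) /=; last first.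
  by apply/eqP/normaliseK/C_part.
have [ecol ecoord] := coloured_indexK c ji.
rewrite scaleE MmapE ?C_part // ecol ecoord normaliseK ?C_part // eqxx mul1r.
rewrite big1 ?addr0 // => d /andP[/eqP dn dc].
by rewrite scaleE MmapE ?C_part // ecol dn (negPf dc) mul0r [LHS]mulr0.
Qed.

Lemma dim_span_Mmap (C : {set blocks k l}) :
  (forall p, p \in C -> finset.partition p [set: points k l]) ->
  free [seq Tmap K N p | p in C] ->
  \dim <<[seq Mmap K N pc.1 pc.2 | pc : blocks k l * {ffun points k l -> G} in
    finset.setX C [set: {ffun points k l -> G}]%SET]>>%VS =
  (\sum_(p in C) \prod_(b in p) #|G| ^ #|b|.-1)%N.
Proof.
move=> C_part freeT.
have freeM := free_normal_Mmap C_part freeT.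
rewrite (@eq_span _ _ _ [seq Mmap K N pc.1 pc.2 |
    pc : blocks k l * {ffun points k l -> G} in
    [pred pc | (pc.1 \in C) && normal_colouring pc.1 pc.2]]); last first.
  move=> M; apply/imageP/imageP => -[[p c]] /=.
    rewrite !inE andbT => pC ->; exists (p, normalise p c) => /=.
      by apply/andP; split=> //=; apply/eqP/normaliseK/C_part.
    by rewrite Mmap_normalise ?C_part.
  by rewrite !inE => /andP[/= pC _] ->; exists (p, c); rewrite // !inE pC.
rewrite (eqP freeM) size_map -cardE -sum1_card.
transitivity (\sum_(p in C) \sum_(d | @normal_colouring G _ _ p d) 1)%N.
  by rewrite pair_big_dep; apply: eq_big => -[].
by apply: eq_bigr => p pC; rewrite sum1_card card_normal_colouring // C_part.
Qed.

End Dimension.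

(** * Moments of the character and fixed vectors *)

Lemma index0_eq (I : Type) (e e' : {ffun 'I_0 -> I}) : e = e'.
Proof. by apply/ffunP => -[]. Qed.

Lemma sum_index0 (M : nmodType) (I : finType) n
    (F : {ffun 'I_n -> I} * {ffun 'I_0 -> I} -> M) e :
  \sum_s F s = \sum_j F (j, e).
Proof.
apply: reindex; exists fst => [//|[j e'] _] /=.
by rewrite (index0_eq e e').
Qed.

Section HaarMoments.
Variables (R : realType) (Q : compact_quantum_group R) (I : finType).
Variables (V : I -> I -> qalg Q) (h : {scalar (qalg Q)}).
Hypothesis V_unitary : unitary_representation V.
Hypothesis h_haar : haar_state h.

(** The j-th column of the Haar projection (id (x) h)(V^n), seen as a linear map
    from the scalars. *)
Definition haar_column (n : nat) (j : {ffun 'I_n -> I}) :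
    tensor_map R[i] I 0 n :=
  [ffun ji => h (tensor_power V ji.1 j)].

Lemma Delta_tensor_power n (i j : {ffun 'I_n -> I}) :
  Delta Q (tensor_power V i j) =
  \sum_z qtens (tensor_power V i z) (tensor_power V z j).
Proof.
have [DV _ _] := V_unitary; have [qt _] := qtens_min Q.
rewrite /tensor_power rmorph_prod /=.
under eq_bigr do rewrite DV.
rewrite bigA_distr_bigA; apply: eq_bigr => z _.
apply: (big_ind3 (fun w x y => w = qtens x y)) => [|_ x y _ x' y' -> ->|//].
  by rewrite (ct_one qt).
exact: (ct_mul qt).
Qed.

(** Invariance of h on the right turns Delta (V^n_ij) into
    sum_z h(V^n_zj) V^n_iz = h(V^n_ij) 1, which is the fixed vector equation for
    the j-th column. *)
Lemma haar_column_intertwiner n (j : {ffun 'I_n -> I}) :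
  intertwiner V (haar_column j).
Proof.
move=> i e; have [_ [sl [sr [_ _ _ srE h_inv]]]] := h_haar.
have [_ h_right] := h_inv (tensor_power V i j).
rewrite Delta_tensor_power linear_sum in h_right.
transitivity (h (tensor_power V i j) *: (1 : qalg Q)).
  rewrite (big_pred1 e) => [|e']; first by rewrite ffunE /tensor_power big_ord0.
  by rewrite (index0_eq e' e) /= eqxx.
by rewrite -h_right; apply: eq_bigr => z _; rewrite ffunE; apply: srE.
Qed.

Lemma intertwiner_haar_fixed n (T : tensor_map R[i] I 0 n) :
  intertwiner V T -> \sum_s T s *: haar_column s.1 = T.
Proof.
move=> T_int; have [[h1 _] _] := h_haar.
apply/ffunP => -[j e]; have /(congr1 h) := T_int j e.
rewrite (big_pred1 e) => [|e']; last by rewrite (index0_eq e' e) /= eqxx.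
rewrite linearZ /= /tensor_power big_ord0 h1 [X in X = _]mulr1 => ->.
rewrite linear_sum sum_ffunE.
rewrite (sum_index0 _ e).
by apply: eq_bigr => j' _; rewrite linearZ !ffunE.
Qed.

(** The character of the n-th tensor power is the n-th power of the character, so
    the moment is the trace of the Haar projection. *)
Lemma moment_eq_dim n (U : {vspace tensor_map R[i] I 0 n}) :
  (forall T, intertwiner V T <-> T \in U) ->
  moment h n (rep_character V) = (\dim U)%:R.
Proof.
move=> UE; pose e0 : {ffun 'I_0 -> I} := ffun0 (card_ord 0).
rewrite -(trace_projector (P := fun s => haar_column s.1)).
- rewrite /moment /rep_character -[n in LHS]card_ord -prodr_const.
  rewrite bigA_distr_bigA linear_sum.
  rewrite (sum_index0 _ e0).
  by apply: eq_bigr => i _; rewrite ffunE.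
- by move=> s; apply/UE/haar_column_intertwiner.
by move=> v /UE; apply: intertwiner_haar_fixed.
Qed.

End HaarMoments.

Theorem proposition3p16 (R : realType) (C : partition_category) (N : nat)
  (hfree : forall k l : nat,
     free [seq Tmap R[i] N p | p : blocks k l in C k l])
  (G : finGroupType) (Q : compact_quantum_group R)
  (V : G * 'I_N -> G * 'I_N -> qalg Q)
  (hV : partition_wreath_product C V)
  (h : {scalar (qalg Q)}) (hh : haar_state h) (n : nat) :
  moment h n (rep_character V) =
  (\sum_(p in C 0%N n) \prod_(b in p) #|G| ^ #|b|.-1)%N%:R.
Proof.
have [V_unitary _ V_int] := hV.
rewrite (moment_eq_dim V_unitary hh (V_int 0%N n)).
by rewrite dim_span_Mmap // => p; apply: pcat_partition.
Qed.
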